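(* Let $(X,\|\cdot\|)$ be a two-dimensional real normed space. The norm $\|\cdot\|$ is not Euclidean if and only if there exists some $x\in X$, $x\neq 0$, such that for each $\lambda\in(0,+\infty)\setminus\{1\}$ there exists $y\in X$ with $\|y\|=\lambda\|x\|$, $\langle x,y\rangle=X$ (i.e. $x,y$ are linearly independent), and $B(-x,x)\cap B(-y,y)\neq\{0\}$.
   Context: A norm is Euclidean if it is induced by an inner product. For $u,v\in X$, the bisector of $u$ and $v$ is $B(u,v)=\{w\in X:\|u-w\|=\|v-w\|\}$. $\langle x,y\rangle$ denotes the linear span of $x,y$. *)

(* Defs.v *)
(* a two-dimensional real normed space is a vectType V over
   R : realType with \dim fullv = 2, together with a norm function N. *)
From HB Require Import structures.
From mathcomp Require Import all_boot all_order all_algebra.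
From mathcomp Require Import classical_sets reals.
Set Implicit Arguments. Unset Strict Implicit. Unset Printing Implicit Defensive.
Import Order.TTheory GRing.Theory Num.Theory.
Local Open Scope ring_scope.
Local Open Scope classical_set_scope.

Definition is_norm (R : realType) (V : lmodType R) (N : V -> R) : Prop :=
  [/\ forall x, N x = 0 -> x = 0,
      forall (a : R) x, N (a *: x) = `|a| * N x &
      forall x y, N (x + y) <= N x + N y].

Definition is_inner_product (R : realType) (V : lmodType R) (ip : V -> V -> R) : Prop :=
  [/\ forall x y, ip x y = ip y x,
      forall (a : R) x y z, ip (a *: x + y) z = a * ip x z + ip y z &
      forall x, x != 0 -> 0 < ip x x].

Definition euclidean_norm (R : realType) (V : lmodType R) (N : V -> R) : Prop :=
  exists ip : V -> V -> R, is_inner_product ip /\ forall x, N x = Num.sqrt (ip x x).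

Definition bisector (R : realType) (V : lmodType R) (N : V -> R) (u v : V) : set V :=
  [set w | N (u - w) = N (v - w)].

(* Main.v *)
(* Call w and x isosceles orthogonal when |w + x| = |w - x|, that is, when w lies
   in B(-x, x).  If the unit sphere contains a segment m + [-1, 1] d, then x = m
   works, with w a small multiple of d.  Otherwise the norm is strictly convex;
   if x fails for l, then, since B(-w, w) meets the sphere of radius l |x|, any w
   orthogonal to x is orthogonal to l x.  By scaling, w is orthogonal to
   arbitrarily small multiples of x, so w is the point of the line w + R x closest
   to 0, and B(-x, x) is a line.  If this happens for every x, each x is reversed
   by an isometric reflection, unit vectors can be swapped by isometries, and the
   unit sphere is an ellipse. *)
Require Import Defs.
From HB Require Import structures.
From mathcomp Require Import all_boot all_order all_algebra.
From mathcomp Require Import boolp classical_sets reals.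
From mathcomp Require Import topology normedtype sequences.
From mathcomp Require Import ring lra.
Import Order.TTheory GRing.Theory Num.Theory numFieldNormedType.Exports.
Local Open Scope ring_scope.
Local Open Scope classical_set_scope.

Set Implicit Arguments.
Unset Strict Implicit.
Unset Printing Implicit Defensive.

(** * Linear combinations of two vectors and bases of a plane *)

Lemma lincombD (R : pzRingType) (V : lmodType R) (u v : V) (a b c d : R) :
  a *: u + b *: v + (c *: u + d *: v) = (a + c) *: u + (b + d) *: v.
Proof. by rewrite addrACA -!scalerDl. Qed.

Lemma lincombZ (R : pzRingType) (V : lmodType R) (u v : V) (k a b : R) :
  k *: (a *: u + b *: v) = (k * a) *: u + (k * b) *: v.
Proof. by rewrite scalerDr !scalerA. Qed.

Section Plane.
Variables (R : realType) (V : vectType R).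
Hypothesis dimV : \dim (fullv : {vspace V}) = 2%N.

Lemma span2P (x y : V) : <<[:: x; y]>>%VS = fullv ->
  forall v, exists a b, v = a *: x + b *: y.
Proof.
move=> xyV v; have : v \in <<[:: x; y]>>%VS by rewrite xyV memvf.
rewrite span_cons span_seq1 => /memv_addP[_ /vlineP[a ->]] [_ /vlineP[b ->] ->].
by exists a, b.
Qed.

Lemma span2_full (x y : V) : x != 0 -> (forall c, y <> c *: x) ->
  <<[:: x; y]>>%VS = fullv.
Proof.
move=> x0 yx; have yNx : y \notin <[x]>%VS by apply/vlineP => -[c /yx].
have free_xy : free [:: y; x] by rewrite free_cons span_seq1 yNx seq1_free.
have -> : <<[:: x; y]>>%VS = <<[:: y; x]>>%VS.
  by rewrite !span_cons !span_nil !addv0 addvC.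
by apply/eqP; rewrite eqEdim subvf dimV /=; move: free_xy; rewrite /free => /eqP ->.
Qed.

Lemma span2_free (x y : V) : <<[:: x; y]>>%VS = fullv ->
  forall a b, a *: x + b *: y = 0 -> a = 0 /\ b = 0.
Proof.
move=> xyV a b ab0.
have /freeP/(_ (fun i => [:: a; b]`_i)) : free [:: x; y].
  by rewrite /free xyV dimV.
rewrite !big_ord_recl big_ord0 /= addr0 => /(_ ab0) h.
by split; [exact: (h ord0)|exact: (h (lift ord0 ord0))].
Qed.

Lemma span2_exists (x : V) : x != 0 -> exists y, <<[:: x; y]>>%VS = fullv.
Proof.
move=> x0; case: (pselect (exists y, forall c, y <> c *: x)) => [[y yx]|Nex].
  by exists y; apply: span2_full.
have : \dim (fullv : {vspace V}) = \dim <[x]>%VS.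
  congr (\dim _); apply/vspaceP => y; rewrite memvf; apply/esym/vlineP.
  by apply: contrapT => yx; apply: Nex; exists y => c yc; apply: yx; exists c.
by rewrite dimV dim_vline x0.
Qed.

End Plane.

(** * Norms along lines: convexity, flat segments, continuity *)

Section Norm.
Variables (R : realType) (V : lmodType R) (N : V -> R).
Hypothesis hN : is_norm N.

Lemma norm_eq0 x : N x = 0 -> x = 0. Proof. by case: hN => + _ _; exact. Qed.
Lemma normZ a x : N (a *: x) = `|a| * N x. Proof. by case: hN. Qed.
Lemma normD x y : N (x + y) <= N x + N y. Proof. by case: hN. Qed.

Lemma norm0 : N 0 = 0.
Proof. by rewrite -(scale0r 0) normZ normr0 mul0r. Qed.

Lemma normN x : N (- x) = N x.
Proof. by rewrite -scaleN1r normZ normrN normr1 mul1r. Qed.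

Lemma norm_distC x y : N (x - y) = N (y - x).
Proof. by rewrite -normN opprB. Qed.

Lemma norm_ge0 x : 0 <= N x.
Proof. by have := normD x (- x); rewrite subrr norm0 normN; lra. Qed.

Lemma norm_gt0 x : x != 0 -> 0 < N x.
Proof.
by move=> x0; rewrite lt_def norm_ge0 andbT; apply: contra_neq x0; exact: norm_eq0.
Qed.

Lemma norm_dist_dist x y : `|N x - N y| <= N (x - y).
Proof.
have := normD (x - y) y; have := normD (y - x) x.
by rewrite !subrK (norm_distC y) => ? ?; rewrite ler_norml; lra.
Qed.

Lemma norm_line_le (z x : V) (t1 t2 t3 M : R) : t1 <= t2 -> t2 <= t3 ->
  N (z + t1 *: x) <= M -> N (z + t3 *: x) <= M -> N (z + t2 *: x) <= M.
Proof.
move=> t12 t23 h1 h3.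
have [t13|t13] := ltP t1 t3; last by have <- : t1 = t2 by lra.
have -> : z + t2 *: x = ((t3 - t2) / (t3 - t1)) *: (1 *: z + t1 *: x)
      + ((t2 - t1) / (t3 - t1)) *: (1 *: z + t3 *: x).
  rewrite !lincombZ lincombD -{1}[z]scale1r.
  by congr (_ *: _ + _ *: _); field; lra.
apply: (le_trans (normD _ _)); rewrite !normZ scale1r.
have a0 : 0 <= (t3 - t2) / (t3 - t1) by apply: divr_ge0; lra.
have b0 : 0 <= (t2 - t1) / (t3 - t1) by apply: divr_ge0; lra.
have ab : (t3 - t2) / (t3 - t1) + (t2 - t1) / (t3 - t1) = 1 by field; lra.
rewrite !ger0_norm //.
move: a0 b0 ab; set a := _ / _; set b := _ / _ => a0 b0 ab.
rewrite -[M]mul1r -ab mulrDl; apply: lerD; exact: ler_wpM2l.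
Qed.

(** Strict quasiconvexity along every line, equivalent to the absence of segments in spheres centred
    at [0]; this form compares three points of a line directly. *)
Definition strictly_convex_norm := forall (z x : V) (t1 t2 t3 : R), x != 0 ->
  t1 < t2 -> t2 < t3 ->
  N (z + t2 *: x) < Num.max (N (z + t1 *: x)) (N (z + t3 *: x)).

(** If the value at [t2] is at least both outer values, convexity makes it the maximum on an
    interval centred at [t2]. Two opposite values have a mean at least the central one, so all are
    equal. *)
Lemma flat_or_strictly_convex :
  (exists m d, d != 0 /\ forall h, `|h| <= 1 -> N (m + h *: d) = N m) \/
  strictly_convex_norm.
Proof.
case: (pselect strictly_convex_norm) => [|nsc]; [by right|left].
apply: contrapT => nflat; apply: nsc => z x t1 t2 t3 x0 t12 t23.
rewrite ltNge; apply/negP => le_max; apply: nflat.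
pose s := Num.min (t2 - t1) (t3 - t2).
have [s0 s1 s3] : [/\ 0 < s, s <= t2 - t1 & s <= t3 - t2].
  by rewrite /s lt_min !ge_min !lexx orbT; split=> //; lra.
exists (z + t2 *: x), (s *: x); split; first by rewrite scaler_eq0 negb_or x0 gt_eqF.
have le_m h : `|h| <= 1 -> N (z + t2 *: x + h *: (s *: x)) <= N (z + t2 *: x).
  move=> h1; have : `|h * s| <= s.
    by rewrite normrM (gtr0_norm s0) ler_piMl // ltW.
  rewrite ler_norml => /andP[hs1 hs2]; apply: le_trans le_max.
  rewrite scalerA -addrA -scalerDl.
  by apply: (@norm_line_le _ _ t1 _ t3); rewrite ?le_max ?lexx ?orbT //; lra.
move=> h h1; apply/eqP; rewrite eq_le le_m //=.
have := le_m (- h); rewrite normrN => /(_ h1).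
have := normD (z + t2 *: x + h *: (s *: x)) (z + t2 *: x + (- h) *: (s *: x)).
rewrite addrACA -scalerDl subrr scale0r addr0 -mulr2n -scaler_nat normZ.
by rewrite ger0_norm; lra.
Qed.

(** The reverse triangle inequality bounds the variation by that of the two coordinates. Working in
    coordinates avoids a topology on [V]. *)
Lemma norm_line_continuous (u v : V) (a b : R -> R) :
  continuous a -> continuous b -> continuous (fun t => N (a t *: u + b t *: v)).
Proof.
move=> ca cb t; apply/cvgrPdist_lt => e e0.
pose K := N u + N v + 1.
have K0 : 0 < K by have := norm_ge0 u; have := norm_ge0 v; rewrite /K; lra.
have eK : 0 < e / K by apply: divr_gt0.
have /cvgrPdist_lt/(_ _ eK) ha := ca t; have /cvgrPdist_lt/(_ _ eK) hb := cb t.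
near=> s.
apply: (le_lt_trans (norm_dist_dist _ _)).
have -> : a t *: u + b t *: v - (a s *: u + b s *: v)
    = (a t - a s) *: u + (b t - b s) *: v.
  by rewrite opprD addrACA -!scalerBl.
apply: (le_lt_trans (normD _ _)); rewrite !normZ.
have h1 : `|a t - a s| <= e / K by apply/ltW; near: s.
have h2 : `|b t - b s| <= e / K by apply/ltW; near: s.
have := ler_wpM2r (norm_ge0 u) h1; have := ler_wpM2r (norm_ge0 v) h2.
have : e = e / K * (N u + N v) + e / K by rewrite /K; field; rewrite gt_eqF.
lra.
Unshelve. all: by end_near. Qed.

End Norm.

(** * Small powers and zeros of continuous real functions *)

Lemma expr_small (R : archiRealFieldType) (m e : R) : 0 < m -> m < 1 -> 0 < e ->
  exists n, m ^+ n < e.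
Proof.
move=> m0 m1 e0; have := @cvg_expr R m; rewrite gtr0_norm // => /(_ m1).
move=> /cvgrPdist_lt/(_ e e0)[n _ /(_ n (leqnn n))].
by rewrite sub0r normrN gtr0_norm ?exprn_gt0 // => ?; exists n.
Qed.

Lemma IVT0 (R : realType) (f : R -> R) (a b : R) : a <= b -> continuous f ->
  f a <= 0 -> 0 <= f b -> exists t, f t = 0.
Proof.
move=> ab fc fa fb; have [||c _ fc0] := @IVT R f a b 0 ab; last by exists c.
- exact: continuous_subspaceT.
- by rewrite ge_min fa le_max fb orbT.
Qed.

(** * Isosceles orthogonality: existence, uniqueness, contraction *)

Section Isosceles.
Variables (R : realType) (V : lmodType R) (N : V -> R).
Hypothesis hN : is_norm N.

Definition isosceles (w x : V) := N (w + x) = N (w - x).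

Lemma isoscelesC w x : isosceles w x -> isosceles x w.
Proof. by rewrite /isosceles addrC => ->; rewrite norm_distC. Qed.

Lemma isoscelesN w x : isosceles w x -> isosceles w (- x).
Proof. by rewrite /isosceles opprK. Qed.

Lemma isoscelesZ c w x : isosceles w x -> isosceles (c *: w) (c *: x).
Proof. by rewrite /isosceles -scalerDr -scalerBr !(normZ hN) => ->. Qed.

Lemma bisectorP w x : bisector N (- x) x w <-> isosceles w x.
Proof.
rewrite /bisector /isosceles /= -opprD (normN hN) (addrC x) (norm_distC hN x).
by [].
Qed.

(** An arc from [- w] to [w] that avoids [0] is projected radially to the sphere of radius [r]; the
    difference of the two norms changes sign between its ends. *)
Lemma isosceles_sphere (w u : V) (r : R) :
    (forall a b, a *: w + b *: u = 0 -> a = 0 /\ b = 0) -> 0 < r ->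
  exists y, N y = r /\ isosceles w y.
Proof.
move=> wu r0; pose c (t : R) := t *: w + (1 - t ^+ 2) *: u.
have idc : continuous (fun t : R => t) by move=> t; exact: cvg_id.
have c2 : continuous (fun t : R => 1 - t ^+ 2).
  move=> t; apply: cvgB; first exact: cvg_cst.
  by apply: cvgM; exact: idc.
have nc_cont : continuous (fun t => N (c t)) by exact: norm_line_continuous.
have c0 t : 0 < N (c t).
  apply: norm_gt0 => //; apply/eqP => /wu[t0].
  by rewrite t0 expr0n subr0 => /eqP; rewrite oner_eq0.
(* [F t] is [N (w + y) - N (w - y)] multiplied by [N (c t)], for [y] the projection of [c t];
   clearing this denominator leaves continuous coordinates. *)
pose F t := N ((N (c t) + r * t) *: w + (r * (1 - t ^+ 2)) *: u)
          - N ((N (c t) - r * t) *: w + (- (r * (1 - t ^+ 2))) *: u).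
have F_cont : continuous F.
  have rt : continuous (fun t : R => r * t).
    by move=> t; apply: cvgM; [exact: cvg_cst|].
  have rt2 : continuous (fun t : R => r * (1 - t ^+ 2)).
    by move=> t; apply: cvgM; [exact: cvg_cst|exact: c2].
  move=> t; apply: cvgB; apply: norm_line_continuous => //.
  - by move=> s; apply: cvgD; [exact: nc_cont|exact: rt].
  - by move=> s; apply: cvgB; [exact: nc_cont|exact: rt].
  - by move=> s; apply: cvgN; exact: rt2.
have sqN1 : (- 1 : R) ^+ 2 = 1 by rewrite sqrrN expr1n.
have Nw : 0 <= N w by exact: norm_ge0.
have le_dist : `|N w - r| <= `|N w + r|.
  by rewrite (ger0_norm (_ : 0 <= N w + r)) ?ler_norml; lra.
have [|||t] := @IVT0 R F (-1) 1 _ F_cont.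
- by lra.
- rewrite /F /c sqN1 !subrr !mulr0 oppr0 !scale0r !addr0 scaleN1r.
  by rewrite (normN hN) !(normZ hN) mulrN1 opprK; have := ler_wpM2r Nw le_dist; lra.
- rewrite /F /c expr1n !subrr !mulr0 oppr0 !scale0r !addr0 scale1r.
  by rewrite !(normZ hN) mulr1; have := ler_wpM2r Nw le_dist; lra.
move=> /eqP; rewrite subr_eq0 => /eqP Ft.
exists ((r / N (c t)) *: c t); split.
  rewrite (normZ hN) ger0_norm; first by rewrite divfK // gt_eqF.
  by rewrite divr_ge0 // ltW.
have -> : w = (N (c t))^-1 *: (N (c t) *: w).
  by rewrite scalerA mulVf ?scale1r // gt_eqF.
rewrite [r / _]mulrC -scalerA; apply: isoscelesZ; rewrite /isosceles.
have e k : N (c t) *: w + k *: (r *: c t)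
    = (N (c t) + k * (r * t)) *: w + (k * (r * (1 - t ^+ 2))) *: u.
  rewrite -[N (c t) *: w]addr0 -(scale0r u) !lincombZ lincombD.
  by rewrite add0r.
by have := e 1; have := e (- 1); rewrite scaleN1r scale1r !mulN1r !mul1r => -> ->.
Qed.

Lemma isosceles_line (z x : V) : x != 0 -> exists s, isosceles (z + s *: x) x.
Proof.
move=> x0; have Nx := norm_gt0 hN x0; have Nz := norm_ge0 hN z.
pose F s := N (1 *: z + (s + 1) *: x) - N (1 *: z + (s - 1) *: x).
have F_cont : continuous F.
  have c1 : continuous (fun _ : R => 1 : R) by move=> t; exact: cvg_cst.
  have cD k : continuous (fun s : R => s + k).
    by move=> s; apply: cvgD; [exact: cvg_id|exact: cvg_cst].
  by move=> t; apply: cvgB; exact: (norm_line_continuous hN c1 (cD _)).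
(* Once [N (z + (s - 1) *: y)] exceeds [N z], convexity from parameter [0] forces growth up to
   [s + 1]. Taking [y] to be [x] or [- x] handles both ends of the line. *)
have grow (y : V) s : N y = N x -> 1 < s -> 2 * N z / N x < s - 1 ->
    N (z + (s - 1) *: y) <= N (z + (s + 1) *: y).
  move=> yx s1; rewrite ltr_pdivrMr // => zs.
  have Nzs : N z < N (z + (s - 1) *: y).
    have := normD hN (z + (s - 1) *: y) (- z).
    by rewrite addrAC subrr add0r (normN hN) (normZ hN) ger0_norm ?yx; lra.
  have := @norm_line_le _ _ _ hN z y 0 (s - 1) (s + 1)
    (Num.max (N z) (N (z + (s + 1) *: y))).
  rewrite scale0r addr0 !le_max !lexx orbT (leNgt _ (N z)) Nzs /=.
  by apply=> //; lra.
pose S := 2 * N z / N x + 2.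
have S1 : 1 < S.
  have : 0 <= 2 * N z / N x by rewrite divr_ge0 ?mulr_ge0 ?(ltW Nx).
  by rewrite /S; lra.
have S2 : 2 * N z / N x < S - 1 by rewrite /S; lra.
have [|||s] := @IVT0 R F (- S) S _ F_cont.
- by lra.
- have := grow (- x) S (normN hN x) S1 S2; rewrite /F !scale1r !scalerN -!scaleNr.
  have -> : - (S - 1) = - S + 1 by ring.
  have -> : - (S + 1) = - S - 1 by ring.
  by lra.
- by have := grow x S erefl S1 S2; rewrite /F !scale1r; lra.
rewrite /F !scale1r => /eqP; rewrite subr_eq0 => /eqP Fs.
exists s; rewrite /isosceles -!addrA -[X in _ *: x + X]scale1r.
rewrite -[X in _ *: x - X]scale1r.
by rewrite -scalerDl -scalerBl.
Qed.

(** Let [f r = N (w + r *: x)]. Two solutions at distance [t > 0] give [f (-1) = f 1] and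
    [f (t - 1) = f (t + 1)]; strict convexity on [[-1, t + 1]] then yields both [f 1 < f (t + 1)]
    and [f (t - 1) < f (-1)], a contradiction. *)
Lemma isosceles_line_unique (w x : V) (s : R) : strictly_convex_norm N -> x != 0 ->
  isosceles w x -> isosceles (w + s *: x) x -> s = 0.
Proof.
move=> sc x0.
have key v t : 0 < t -> isosceles v x -> isosceles (v + t *: x) x -> False.
  rewrite /isosceles => t0; rewrite -!addrA -{1 4}[x]scale1r -{2 6}[x]scale1r.
  rewrite -!scaleNr -!scalerDl => e1 e2.
  have := @sc v x (- 1) 1 (t + 1) x0.
  have := @sc v x (- 1) (t - 1) (t + 1) x0.
  by rewrite !lt_max => /(_ ltac:(lra) ltac:(lra))/orP[] ?
    /(_ ltac:(lra) ltac:(lra))/orP[] ?; lra.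
move=> wx wsx; have [s0|s0|//] := ltgtP s 0.
- case: (@key (w + s *: x) (- s)) => //; first by lra.
  by rewrite scaleNr addrK.
- by case: (@key w s).
Qed.

Lemma isosceles_contraction (x : V) (l : R) : strictly_convex_norm N -> x != 0 ->
    0 < l -> l != 1 -> (forall w, isosceles w x -> isosceles w (l *: x)) ->
  exists m, [/\ 0 < m, m < 1 & forall w, isosceles w x -> isosceles w (m *: x)].
Proof.
move=> sc x0 l0 l1 lP; have [lt1|gt1|e] := ltgtP l 1; first by exists l.
  (* For [l > 1] the implication has to be reversed. The point of the line [l *: w + R x] orthogonal
     to [x] is also orthogonal to [l *: x], as is [l *: w]; by uniqueness they coincide, and scaling
     by [l^-1] concludes. *)
  exists l^-1; split; [by rewrite invr_gt0|by rewrite invf_lt1|] => w wx.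
  have [s ws] := isosceles_line (l *: w) x0.
  have lx0 : l *: x != 0 by rewrite scaler_eq0 negb_or x0 gt_eqF.
  have /(isosceles_line_unique sc lx0 (isoscelesZ l wx)) sl0 :
      isosceles (l *: w + (s / l) *: (l *: x)) (l *: x).
    by rewrite scalerA divfK ?gt_eqF //; exact: lP.
  have s0 : s = 0 by rewrite -[s](divfK (_ : l != 0)) ?gt_eqF // sl0 mul0r.
  move: ws; rewrite s0 scale0r addr0 => /(isoscelesZ l^-1).
  by rewrite scalerA mulVf ?gt_eqF // scale1r.
by rewrite e eqxx in l1.
Qed.

(* Scaling turns the contraction into [isosceles w (m ^+ n *: x)] for all [n]:
   [t |-> N (w + t *: x)] takes equal values at points [- e], [e] with [e] as
   small as we please, so its minimum is at [0]. *)
Lemma isosceles_minimal (x w : V) (m : R) : strictly_convex_norm N -> x != 0 ->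
    0 < m -> m < 1 -> (forall w, isosceles w x -> isosceles w (m *: x)) ->
    isosceles w x ->
  forall t, t != 0 -> N w < N (w + t *: x).
Proof.
move=> sc x0 m0 m1 mP wx t t0.
have iter n v : isosceles v x -> isosceles v (m ^+ n *: x).
  elim: n v => [|n IH] v vx; first by rewrite expr0 scale1r.
  have : isosceles (m^-1 *: v) x.
    have /(isoscelesZ m^-1) := mP v vx.
    by rewrite scalerA mulVf ?gt_eqF // scale1r.
  move=> /IH/(isoscelesZ m); rewrite !scalerA mulfV ?gt_eqF // scale1r.
  by rewrite -exprS.
have abs_t : 0 < `|t| by rewrite normr_gt0.
have [n] := expr_small m0 m1 abs_t.
have := iter n w wx; have : 0 < m ^+ n by rewrite exprn_gt0.
move: (m ^+ n) => e e0; rewrite /isosceles -scaleNr => ee et.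
have Nw : N w <= N (w + e *: x).
  have := @norm_line_le _ _ _ hN w x (- e) 0 e (N (w + e *: x)).
  by rewrite scale0r addr0; apply; rewrite ?ee //; lra.
apply: (le_lt_trans Nw).
have [t_pos|t_neg] := ltP 0 t.
  move: et; rewrite gtr0_norm // => et.
  by have := sc w x (- e) e t x0; rewrite lt_max -ee ltxx /=; apply; lra.
move: et; rewrite ler0_norm // => et.
by have := sc w x t (- e) e x0; rewrite lt_max -ee ltxx orbF /=; apply; lra.
Qed.

End Isosceles.

(** * Reflections, symmetries of the unit circle, and the inner product *)

Section Axes.
Variables (R : realType) (V : vectType R) (N : V -> R).
Hypotheses (dimV : \dim (fullv : {vspace V}) = 2%N) (hN : is_norm N).
Hypothesis scN : strictly_convex_norm N.
Hypothesis contraction : forall x : V, x != 0 -> exists m,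
  [/\ 0 < m, m < 1 & forall w, isosceles N w x -> isosceles N w (m *: x)].

(** The vector [v] is the nearest point to [0] on a line parallel to [x]. By homogeneity the nearest
    points of all parallel lines are multiples of [v], so the linear reflection negating [x] and
    fixing [v] is an isometry. *)
Lemma isosceles_axis (x : V) : x != 0 -> exists v,
  <<[:: x; v]>>%VS = fullv /\ forall a b, isosceles N (b *: v) (a *: x).
Proof.
move=> x0; have [m [m0 m1 mP]] := contraction x0.
have min := isosceles_minimal hN scN x0 m0 m1 mP.
have [u xu] := span2_exists dimV x0; have [s us] := isosceles_line hN u x0.
exists (u + s *: x); split.
  apply: span2_full => // c ucx.
  have /(span2_free dimV xu)[_ /eqP] : (c - s) *: x + (- 1) *: u = 0.
    by rewrite scalerBl -ucx addrK scaleN1r subrr.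
  by rewrite oppr_eq0 oner_eq0.
move: (u + s *: x) us => v vx.
have axis b : isosceles N (b *: v) x.
  have [->|b0] := eqVneq b 0.
    by rewrite /isosceles scale0r add0r sub0r (normN hN).
  have [t bt] := isosceles_line hN (b *: v) x0.
  have [t0|t0] := eqVneq t 0; first by move: bt; rewrite t0 scale0r addr0.
  (* If the orthogonal point were [b *: v + t *: x] with [t] nonzero, it would be strictly closer to
     [0] than [b *: v], against the minimality of [v] scaled by [b]. *)
  have := min _ bt (- t); rewrite oppr_eq0 => /(_ t0).
  rewrite scaleNr addrK.
  have -> : b *: v + t *: x = b *: (v + (t / b) *: x).
    by rewrite scalerDr scalerA mulrCA mulfV // mulr1.
  rewrite !(normZ hN) ltr_pM2l ?normr_gt0 // => lt1.
  have := min _ vx (t / b); rewrite mulf_eq0 invr_eq0 negb_or t0 b0 => /(_ isT).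
  by lra.
move=> a b; have [->|a0] := eqVneq a 0.
  by rewrite /isosceles scale0r addr0 subr0.
have -> : b *: v = a *: ((b / a) *: v) by rewrite scalerA mulrCA mulfV // mulr1.
exact: isoscelesZ.
Qed.

(* The axis of [p - q] contains [p + q], so the reflection in it swaps [p] and [q]. *)
Lemma norm_swap (p q : V) (a b : R) : N p = N q ->
  N (a *: p + b *: q) = N (b *: p + a *: q).
Proof.
move=> pq; have [->|p_neq_q] := eqVneq p q; first by rewrite addrC.
have x0 : p - q != 0 by rewrite subr_eq0.
have [v [xv axis]] := isosceles_axis x0.
have [d [c pqE]] := span2P xv (p + q).
(* Both [c *: v] and [p + q = d *: x + c *: v], for [x = p - q], are orthogonal to [x], the latter
   because [N p = N q]. *)
have d0 : d = 0.
  apply: (isosceles_line_unique scN x0 (w := c *: v)).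
    by have := axis 1 c; rewrite scale1r.
  rewrite addrC -pqE /isosceles addrACA subrr addr0 opprB (addrC p q).
  rewrite addrACA subrr addr0.
  have double (y : V) : y + y = 2 *: y by rewrite scaler_nat mulr2n.
  by rewrite !double !(normZ hN) pq.
have e k l : k *: p + l *: q = ((k + l) / 2) *: (p + q) + ((k - l) / 2) *: (p - q).
  have -> : p - q = 1 *: p + (- 1) *: q by rewrite scale1r scaleN1r.
  have -> : p + q = 1 *: p + 1 *: q by rewrite !scale1r.
  rewrite !lincombZ lincombD.
  by congr (_ *: _ + _ *: _); field.
rewrite !e [b + a]addrC -[b - a]opprB mulNr scaleNr.
by rewrite pqE d0 scale0r add0r scalerA; exact: axis.
Qed.

(** Take [f] to be the normalized axis of [e]: the reflection negates [e], and equal norms allow the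
    swap. These two isometries generate the symmetry group of a square. *)
Lemma dihedral_basis : exists e f : V, [/\ <<[:: e; f]>>%VS = fullv, N e = 1,
  forall a b, N (a *: e + b *: f) = N ((- a) *: e + b *: f) &
  forall a b, N (a *: e + b *: f) = N (b *: e + a *: f)].
Proof.
have e0 : vpick (fullv : {vspace V}) != 0 by rewrite vpick0 -dimv_eq0 dimV.
move: (vpick _) e0 => e0 e0_neq0.
have Ne0 := norm_gt0 hN e0_neq0.
pose e := (N e0)^-1 *: e0.
have Ne : N e = 1.
  by rewrite (normZ hN) ger0_norm ?invr_ge0 ?(ltW Ne0) // mulVf // gt_eqF.
have e_neq0 : e != 0 by rewrite scaler_eq0 negb_or invr_eq0 e0_neq0 gt_eqF.
have [v [ev axis]] := isosceles_axis e_neq0.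
have v0 : v != 0.
  apply/eqP => v0; have := span2_free dimV ev (a := 0) (b := 1).
  by rewrite v0 scale0r scaler0 addr0 => /(_ erefl)[_ /eqP]; rewrite oner_eq0.
have Nv := norm_gt0 hN v0.
exists e, ((N v)^-1 *: v); split=> //.
- apply: span2_full => // c vce.
  have := span2_free dimV ev (a := c) (b := - (N v)^-1).
  rewrite -vce scaleNr subrr => /(_ erefl)[_ /eqP].
  by rewrite oppr_eq0 invr_eq0 gt_eqF.
- move=> a b; rewrite scaleNr [b *: (_ *: v)]scalerA [LHS](congr1 N (addrC _ _)).
  by rewrite [- _ + _]addrC; exact: axis.
- move=> a b; apply: norm_swap.
  by rewrite Ne (normZ hN) ger0_norm ?invr_ge0 ?(ltW Nv) // mulVf // gt_eqF.
Qed.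

(* With [p = a *: e + b *: f], composing the isometry swapping [e] and [p] with
   the quarter turn [e -> f -> - e] gives an isometry of determinant [-1] and
   trace [(1 - a ^+ 2 - b ^+ 2) / b]. Its real eigenvalue [m] has modulus [1] and
   [m ^+ 2 - 1] is [m] times the trace, so the trace is [0]. *)
Lemma unit_circle (e f : V) (a b : R) : <<[:: e; f]>>%VS = fullv -> N e = 1 ->
    (forall a b, N (a *: e + b *: f) = N ((- a) *: e + b *: f)) ->
    (forall a b, N (a *: e + b *: f) = N (b *: e + a *: f)) ->
  N (a *: e + b *: f) = 1 -> a ^+ 2 + b ^+ 2 = 1.
Proof.
move=> ef Ne symN symC Np.
have sq1 (c : R) : `|c| = 1 -> c ^+ 2 = 1.
  by move=> c1; rewrite -real_normK ?num_real // c1 expr1n.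
have [b0|b0] := eqVneq b 0.
  move: Np; rewrite b0 scale0r addr0 (normZ hN) Ne mulr1 => /sq1 ->.
  by rewrite expr0n addr0.
have [a0|a0] := eqVneq a 0.
  move: Np; rewrite symC a0 scale0r addr0 (normZ hN) Ne mulr1 => /sq1 ->.
  by rewrite expr0n add0r.
pose k := a ^+ 2 + b ^+ 2 - 1.
(* A root of the characteristic equation [b * m ^+ 2 + k * m - b = 0], whose discriminant is
   nonnegative. *)
pose m := (- k + Num.sqrt (k ^+ 2 + 4 * b ^+ 2)) / (2 * b).
have mE : b * m ^+ 2 + k * m - b = 0.
  have disc : 0 <= k ^+ 2 + 4 * b ^+ 2.
    by rewrite addr_ge0 ?sqr_ge0 // mulr_ge0 // sqr_ge0.
  have := sqr_sqrtr disc; rewrite /m; set r := Num.sqrt _ => rE.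
  have -> : b * ((- k + r) / (2 * b)) ^+ 2 + k * ((- k + r) / (2 * b)) - b
    = (r ^+ 2 - (k ^+ 2 + 4 * b ^+ 2)) / (4 * b) by field.
  by rewrite rE subrr mul0r.
have swap s t : N ((s + t * a) *: e + (t * b) *: f)
    = N ((- (s * b)) *: e + (t + s * a) *: f).
  have expand x y : x *: e + y *: (a *: e + b *: f) = (x + y * a) *: e + (y * b) *: f.
    by rewrite -[x *: e]addr0 -(scale0r f) lincombZ lincombD add0r.
  by rewrite -expand norm_swap ?Ne ?Np // expand symC symN.
(* These coordinates in the basis [e], [p] give an eigenvector for [m]. Its [f]-coordinate is
   [- a * b], nonzero because the cases [a = 0] and [b = 0] are already settled. *)
have := swap (1 - m * b) (- a).
have -> : - ((1 - m * b) * b) = m * (1 - m * b + - a * a).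
  rewrite -[RHS]addr0 -[X in _ = _ + X]mE /k; ring.
have -> : - a + (1 - m * b) * a = m * (- a * b) by ring.
rewrite -lincombZ (normZ hN); set w := _ + _.
have w0 : w != 0.
  apply/eqP => /(span2_free dimV ef)[_ /eqP].
  by rewrite mulNr oppr_eq0 mulf_eq0 (negbTE a0) (negbTE b0).
move=> Nw; have Nw0 := norm_gt0 hN w0.
have m1 : `|m| = 1.
  by apply: (@mulIf _ (N w)); rewrite ?gt_eqF // -Nw mul1r.
move: mE; rewrite (sq1 _ m1) mulr1 addrAC subrr add0r => /eqP.
rewrite mulf_eq0 => /orP[/eqP|/eqP m0]; first by rewrite /k; lra.
by move: m1; rewrite m0 normr0 => /eqP; rewrite eq_sym oner_eq0.
Qed.

Lemma euclidean_of_contraction : euclidean_norm N.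
Proof.
have [e [f [ef Ne symN symC]]] := dihedral_basis.
have pyth a b : N (a *: e + b *: f) ^+ 2 = a ^+ 2 + b ^+ 2.
  have [/eqP|w0] := eqVneq (a *: e + b *: f) 0.
    move=> /eqP w0; have [-> ->] := span2_free dimV ef w0.
    by rewrite !scale0r addr0 (norm0 hN) expr0n addr0.
  have Nw := norm_gt0 hN w0; set n := N _ in Nw *.
  have : (n^-1 * a) ^+ 2 + (n^-1 * b) ^+ 2 = 1.
    apply: (unit_circle ef Ne symN symC); rewrite -lincombZ (normZ hN).
    by rewrite ger0_norm ?invr_ge0 ?(ltW Nw) // mulVf // gt_eqF.
  move=> /(congr1 (fun r => n ^+ 2 * r)); rewrite mulr1 => <-; field.
  by rewrite gt_eqF.
(* Polarization defines the form from [N] alone, without coordinate functions. *)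
pose ip (x y : V) := (N (x + y) ^+ 2 - N x ^+ 2 - N y ^+ 2) / 2.
have ipE a b c d : ip (a *: e + b *: f) (c *: e + d *: f) = a * c + b * d.
  by rewrite /ip lincombD !pyth; field.
have ipxx x : ip x x = N x ^+ 2.
  by have [a [b ->]] := span2P ef x; rewrite ipE pyth.
exists ip; split; last first.
  by move=> x; rewrite ipxx sqrtr_sqr ger0_norm // norm_ge0.
split.
- by move=> x y; rewrite /ip (addrC x); field.
- move=> k x y z; have [a [b ->]] := span2P ef x.
  have [a' [b' ->]] := span2P ef y; have [c [d ->]] := span2P ef z.
  by rewrite lincombZ lincombD !ipE; ring.
- by move=> x x0; rewrite ipxx exprn_gt0 // norm_gt0.
Qed.

End Axes.

(** * Flat segments, the contrapositive argument, and the equivalence *)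

(** Take [y = l *: m + (l / 2) *: d] and [w = s *: d]. Both [m + w] and [m - w] lie on the segment,
    and both [y + w] and [y - w] on its dilate by [l], as soon as [s <= 1] and [s <= l / 2]. *)
Lemma flat_bisectors (R : realType) (V : vectType R) (N : V -> R)
    (dimV : \dim (fullv : {vspace V}) = 2%N) (hN : is_norm N) (m d : V) :
    d != 0 -> (forall h, `|h| <= 1 -> N (m + h *: d) = N m) ->
  m != 0 /\ forall l, 0 < l -> exists y w, [/\ N y = l * N m,
    <<[:: m; y]>>%VS = fullv, w != 0, isosceles N w m & isosceles N w y].
Proof.
move=> d0 flat; have Nd := norm_gt0 hN d0.
have m0 : m != 0.
  apply/eqP => m0; have := flat 1; rewrite normr1 lexx m0 add0r scale1r (norm0 hN).
  by move=> /(_ isT); lra.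
have Nm := norm_gt0 hN m0; split=> // l l0.
have d_indep c : d <> c *: m.
  (* If [d = c *: m], flatness at [h = 1] and [h = -1] gives [|1 + c| = |1 - c| = 1], hence
     [c = 0]. *)
  move=> dE; have c1 h : `|h| <= 1 -> `|1 + h * c| = 1.
    move=> /flat; rewrite dE scalerA -{1}[m]scale1r -scalerDl (normZ hN) => e.
    by apply: (@mulIf _ (N m)); rewrite ?gt_eqF // mul1r.
  have c0 : c = 0.
    have := c1 1; have := c1 (- 1).
    rewrite normrN normr1 lexx => /(_ isT)/eqP + /(_ isT)/eqP.
    by rewrite !eqr_norml => /andP[/orP[]/eqP ? _] /andP[/orP[]/eqP ? _]; lra.
  by move: d0; rewrite dE c0 scale0r eqxx.
pose s := Num.min 1 (l / 2).
have [s0 s1 sl] : [/\ 0 < s, s <= 1 & s <= l / 2].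
  by rewrite /s lt_min !ge_min !lexx orbT; split=> //; lra.
have Nly h : `|h| <= 1 -> N (l *: m + (l * h) *: d) = l * N m.
  by move=> h1; rewrite -scalerA -scalerDr (normZ hN) flat // gtr0_norm.
exists (l *: m + (l / 2) *: d), (s *: d); split.
- by apply: Nly; rewrite ger0_norm; lra.
- apply: span2_full => // c yE; apply: (@d_indep ((l / 2)^-1 * (c - l))).
  rewrite -scalerA scalerBl -yE addrAC subrr add0r scalerA mulVf ?scale1r //.
  by rewrite gt_eqF // divr_gt0.
- by rewrite scaler_eq0 negb_or d0 gt_eqF.
- apply: isoscelesC => //; rewrite /isosceles -scaleNr.
  by rewrite !flat ?normrN ?gtr0_norm.
- apply: isoscelesC => //; rewrite /isosceles -scaleNr -!addrA -!scalerDl.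
  have e k : l / 2 + k = l * (2^-1 + k / l) by field; rewrite gt_eqF.
  have sl' : s / l <= 2^-1 by rewrite ler_pdivrMr // mulrC.
  have sl0 : 0 <= s / l by rewrite divr_ge0 // ltW.
  by rewrite !e !Nly // ?mulNr ler_norml; lra.
Qed.

Lemma non_euclidean_bisectors (R : realType) (V : vectType R) (N : V -> R)
    (dimV : \dim (fullv : {vspace V}) = 2%N) (hN : is_norm N) :
    ~ euclidean_norm N ->
  exists x, x != 0 /\ forall l, 0 < l -> l != 1 -> exists y w, [/\ N y = l * N x,
    <<[:: x; y]>>%VS = fullv, w != 0, isosceles N w x & isosceles N w y].
Proof.
move=> nE; have [[m [d [d0 flat]]]|scN] := flat_or_strictly_convex hN.
  have [m0 mP] := flat_bisectors dimV hN d0 flat.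
  by exists m; split=> // l l0 _; exact: mP.
apply: contrapT => no_x; apply: nE; apply: euclidean_of_contraction => // x x0.
have [l [l0 l1 no_y]] : exists l, [/\ 0 < l, l != 1 & ~ exists y w,
    [/\ N y = l * N x, <<[:: x; y]>>%VS = fullv, w != 0, isosceles N w x
      & isosceles N w y]].
  apply: contrapT => no_l; apply: no_x; exists x; split=> // l l0 l1.
  by apply: contrapT => no_y; apply: no_l; exists l.
apply: (isosceles_contraction hN scN x0 l0 l1) => w wx.
have [->|w0] := eqVneq w 0.
  by rewrite /isosceles add0r sub0r (normN hN).
have lNx : 0 < l * N x by rewrite mulr_gt0 // norm_gt0.
have [u wu] := span2_exists dimV w0.
have [y [Ny wy]] := isosceles_sphere hN (span2_free dimV wu) lNx.
(* The choice of [l] excludes an independent [y]; comparing norms then leaves only [y = l *: x] or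
   [y = - l *: x]. *)
have [c yc] : exists c, y = c *: x.
  apply: contrapT => no_c; apply: no_y; exists y, w; split=> //.
  by apply: span2_full => // c yc; apply: no_c; exists c.
have : `|c| = l.
  by apply: (@mulIf _ (N x)); rewrite ?gt_eqF ?norm_gt0 // -Ny yc (normZ hN).
case: (ger0P c) => _ cl; first by rewrite -cl -yc.
by rewrite -[l]cl scaleNr -yc; exact: isoscelesN.
Qed.

Theorem theorem3p2 (R : realType) (V : vectType R) (N : V -> R)
    (hdim : \dim (fullv : {vspace V}) = 2%N) (hN : is_norm N) :
  ~ euclidean_norm N <->
  exists x : V, x != 0 /\
    forall l : R, 0 < l -> l != 1 ->
      exists y : V, [/\ N y = l * N x,
                        <<[:: x; y]>>%VS = fullv &
                        bisector N (- x) x `&` bisector N (- y) y <> [set 0]].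
Proof.
have bis0 x : bisector N (- x) x 0 by rewrite /bisector /= !subr0 (normN hN).
split.
  move=> /(non_euclidean_bisectors hdim hN)[x [x0 xP]].
  exists x; split=> // l l0 l1; have [y [w [Ny xy w0 wx wy]]] := xP l l0 l1.
  exists y; split=> // /seteqP[sub _].
  have /eqP := sub w (conj (proj2 (bisectorP hN w x) wx) (proj2 (bisectorP hN w y) wy)).
  exact/negP.
move=> [x [x0 xP]].
(* A single ratio suffices for the converse: under an inner product, [w] in both bisectors is
   orthogonal to the basis [x], [y], hence to itself. *)
have [||y [_ xy ne0]] := xP 2; [by rewrite ltr0n|by rewrite pnatr_eq1|].
move=> [ip [[ipC ipL ip_gt0] NE]]; apply: ne0; apply/seteqP; split=> [w|_ ->] //=.
have ip0 z : ip 0 z = 0 by have := ipL (- 1) 0 0 z; rewrite scaler0 addr0; lra.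
have ipD u v z : ip (u + v) z = ip u z + ip v z.
  by have := ipL 1 u v z; rewrite scale1r mul1r.
have ipZ a u z : ip (a *: u) z = a * ip u z.
  by have := ipL a u 0 z; rewrite !addr0 ip0 addr0.
have ip_ge0 u : 0 <= ip u u.
  by have [->|/ip_gt0/ltW//] := eqVneq u 0; rewrite ip0.
(* Equating [ip (w + z) (w + z)] and [ip (w - z) (w - z)] cancels all but the cross terms. *)
have orth z : bisector N (- z) z w -> ip z w = 0.
  move=> /(bisectorP hN); rewrite /isosceles !NE => /eqP.
  rewrite eqr_sqrt ?ip_ge0 // => /eqP; rewrite -scaleN1r.
  have sqD u v : ip (u + v) (u + v) = ip u u + 2 * ip v u + ip v v.
    by rewrite ipD !(ipC _ (u + v)) !ipD (ipC u v); ring.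
  rewrite !sqD !ipZ !(ipC _ (_ *: z)) !ipZ.
  by lra.
move=> [/orth wx /orth wy]; have [a [b wE]] := span2P xy w.
apply/eqP; apply: contraT => /ip_gt0.
by rewrite {1}wE ipD !ipZ wx wy !mulr0 addr0 ltxx.
Qed.
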